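(* Suppose that the random walk on a growing graph $\mathcal D=(\mathfrak d,G,P)$, started at $v\in V(1)$, is LHaGG (less-homesick as graph growing), and that every $P(n)=P_n$ ($n=1,2,\dots$) is irreducible, reversible and has period $2$. Let $p(n)=\mathring\pi_n(v)$, where $\mathring\pi_n$ denotes the even-time stationary distribution of $P_n$. If $\mathfrak d$ satisfies $$\sum_{n=1}^\infty(\mathfrak d(n)-1)\,p(n)=\infty,$$ then $v$ is recurrent by $\mathcal D$.
   Context: Random walk on a growing graph (RWoGG). A RWoGG is a triple $\mathcal D=(\mathfrak d,G,P)$, where $\mathfrak d:\mathbb Z_{>0}\to\mathbb Z_{\ge0}$ (the duration), $G(n)=(V(n),E(n))$ is a finite simple undirected graph for each $n\ge1$ with $V(n)\subseteq V(n+1)$, $E(n)\subseteq E(n+1)$ and $|\bigcup_nV(n)|=\infty$, and $P(n)$ is a stochastic matrix on $V(n)$ describing a random walk on $G(n)$ (so $P(n)(u,w)>0$ only if $u=w$ or $\{u,w\}\in E(n)$). Put $T_0=0$ and $T_n=\sum_{i=1}^n\mathfrak d(i)$; it is assumed that $T_n\to\infty$, so that the walk is defined at all times. The walk $X_0,X_1,\dots$ started at $v\in V(1)$ is the Markov process with $X_0=v$ in which the transition from $X_t$ to $X_{t+1}$ follows $P(n)$ whenever $T_{n-1}\le t<T_n$. Let $R(t)=\Pr[X_t=v]$. The vertex $v$ is recurrent by $\mathcal D$ if $\sum_{t=1}^\infty R(t)=\infty$, and transient otherwise. LHaGG. Fix $G$, $P$ and the initial vertex $v$; for a duration function $f$ let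 $R_f(t)$ be the return probability at time $t$ for $(f,G,P)$. The walk $(\mathfrak d,G,P)$ is LHaGG if the sequence $(G(n),P(n))_{n\ge1}$ has the following property: for all duration functions $f,g$ with $\sum_{i=1}^nf(i)\le\sum_{i=1}^ng(i)$ for every $n\ge1$, one has $R_f(t)\le R_g(t)$ for every $t\ge 1$. (It is a property of the sequence, not of the particular $\mathfrak d$.) Even-time stationary distribution. If a stochastic matrix $P$ on a finite set $V$ is irreducible, reversible (there is $\mu:V\to\mathbb R_{>0}$ with $\mu(u)P(u,w)=\mu(w)P(w,u)$ for all $u,w$) and has period $2$, let $U=\{u\in V:\exists t',\ P^{2t'}(v,u)\ne0\}$, where $v$ is the initial vertex. The even-time stationary distribution $\mathring\pi$ of $P$ is the unique probability distribution on $V$ vanishing outside $U$ with $\mathring\pi P^2=\mathring\pi$. *)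

(* Defs.v *)
From HB Require Import structures.
From mathcomp Require Import all_boot all_order all_algebra finmap.
From mathcomp Require Import all_classical all_reals all_analysis.

Set Implicit Arguments.
Unset Strict Implicit.
Unset Printing Implicit Defensive.

Import Order.TTheory GRing.Theory Num.Theory.
Import numFieldNormedType.Exports.

Local Open Scope classical_set_scope.
Local Open Scope ring_scope.

(* Sequences indexed by the positive integers are functions on [nat] whose
   value at 0 is never used. *)

Definition sum_infty (R : realType) (u : nat -> R) : Prop :=
  (\sum_(1 <= n < N.+1) u n) @[N --> \oo] --> +oo.

Definition total_time (f : nat -> nat) (n : nat) : nat :=
  (\sum_(1 <= i < n.+1) f i)%N.

Record duration := Duration {
  dur :> nat -> nat;
  dur_infty : total_time dur n @[n --> \oo] --> \oo }.

Lemma phase_ex (f : duration) (t : nat) : exists n, (t < total_time f n)%N.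
Proof.
have /(_ [set m | (t < m)%N]) := @dur_infty f.
move=> /(_ (nbhs_infty_gt t)) [n _ Hn].
by exists n; apply: Hn => /=.
Qed.

(* the n with total_time f (n - 1) <= t < total_time f n *)
Definition phase (f : duration) (t : nat) : nat := ex_minn (phase_ex f t).

Lemma phaseP (f : duration) (t : nat) :
  [/\ (0 < phase f t)%N, (total_time f (phase f t).-1 <= t)%N
    & (t < total_time f (phase f t))%N].
Proof.
rewrite /phase; case: ex_minnP => n Hn nmin.
have n0 : (0 < n)%N by case: n Hn {nmin} => //; rewrite /total_time big_geq.
split=> //; rewrite leqNgt; apply/negP => /nmin.
by rewrite -ltnS prednK // ltnn.
Qed.

Lemma total_time_mono (f : nat -> nat) (m n : nat) :
  (m <= n)%N -> (total_time f m <= total_time f n)%N.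
Proof.
move=> mn; rewrite /total_time [X in (_ <= X)%N](@big_cat_nat _ _ _ m.+1) //=.
exact: leq_addr.
Qed.

Lemma phase_mono (f : duration) (s t : nat) :
  (s <= t)%N -> (phase f s <= phase f t)%N.
Proof.
move=> st; rewrite {1}/phase; case: ex_minnP => n _; apply.
by have [_ _] := phaseP f t; apply: leq_ltn_trans.
Qed.

(* A matrix on a finite set V of vertices is a kernel K : T -> T -> R, of which
   only the entries indexed by V are used. *)

Definition stochastic (R : realType) (T : choiceType) (V : {fset T})
    (K : T -> T -> R) : Prop :=
  (forall u w, u \in V -> w \in V -> 0 <= K u w) /\
  (forall u, u \in V -> \sum_(w <- V) K u w = 1).

Fixpoint kpow (R : realType) (T : choiceType) (V : {fset T})
    (K : T -> T -> R) (t : nat) (u w : T) : R :=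
  if t is s.+1 then \sum_(x <- V) kpow V K s u x * K x w else (u == w)%:R.

Definition irreducible (R : realType) (T : choiceType) (V : {fset T})
    (K : T -> T -> R) : Prop :=
  forall u w, u \in V -> w \in V -> exists t, 0 < kpow V K t u w.

Definition reversible (R : realType) (T : choiceType) (V : {fset T})
    (K : T -> T -> R) : Prop :=
  exists mu : T -> R, (forall u, u \in V -> 0 < mu u) /\
    (forall u w, u \in V -> w \in V -> mu u * K u w = mu w * K w u).

(* m = gcd {t >= 1 | K^t(u, u) > 0} at every state u *)
Definition has_period (R : realType) (T : choiceType) (V : {fset T})
    (K : T -> T -> R) (m : nat) : Prop :=
  forall u, u \in V -> forall k : nat,
    (k %| m)%N <->
    (forall t, (0 < t)%N -> 0 < kpow V K t u u -> (k %| t)%N).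

(* the states u with K^(2t)(v, u) != 0 for some t *)
Definition even_class (R : realType) (T : choiceType) (V : {fset T})
    (K : T -> T -> R) (v : T) : set T :=
  [set u | u \in V /\ exists t, kpow V K (2 * t) v u != 0].

Definition even_stationary (R : realType) (T : choiceType) (V : {fset T})
    (K : T -> T -> R) (v : T) (pi : T -> R) : Prop :=
  [/\ (forall u, u \in V -> 0 <= pi u),
      \sum_(u <- V) pi u = 1,
      (forall u, u \in V -> ~ even_class V K v u -> pi u = 0)
    & (forall w, w \in V -> \sum_(u <- V) pi u * kpow V K 2 u w = pi w)].

(* The pair (G, P) of a random walk on a growing graph. *)
Record growing_walk (R : realType) (T : choiceType) := GrowingWalk {
  vert : nat -> {fset T};
  edge : nat -> rel T;
  trans : nat -> T -> T -> R;
  edge_vert : forall n u w, (0 < n)%N ->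
    edge n u w -> (u \in vert n) && (w \in vert n);
  edge_sym : forall n, (0 < n)%N -> symmetric (edge n);
  edge_irr : forall n, (0 < n)%N -> irreflexive (edge n);
  vert_mono : forall n u, (0 < n)%N -> u \in vert n -> u \in vert n.+1;
  edge_mono : forall n u w, (0 < n)%N -> edge n u w -> edge n.+1 u w;
  vert_infinite : infinite_set (\bigcup_(n in [set k | (0 < k)%N]) [set` vert n]);
  trans_stochastic : forall n, (0 < n)%N -> stochastic (vert n) (trans n);
  trans_edge : forall n u w, (0 < n)%N -> u \in vert n -> w \in vert n ->
    0 < trans n u w -> (u == w) || edge n u w }.

Record rwogg (R : realType) (T : choiceType) := RWoGG {
  rw_dur : duration;
  rw_walk :> growing_walk R T }.

(* law W f v t u = Pr[X_t = u] for the walk X started at v with duration f *)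
Fixpoint law (R : realType) (T : choiceType) (W : growing_walk R T)
    (f : duration) (v : T) (t : nat) (w : T) : R :=
  if t is s.+1 then
    let n := phase f s in
    if w \in vert W n then
      \sum_(u <- vert W n) law W f v s u * trans W n u w
    else 0
  else (w == v)%:R.

Definition return_prob (R : realType) (T : choiceType) (W : growing_walk R T)
    (f : duration) (v : T) (t : nat) : R := law W f v t v.

Definition recurrent (R : realType) (T : choiceType) (D : rwogg R T) (v : T) :
    Prop :=
  sum_infty (return_prob D (rw_dur D) v).

Definition lhagg (R : realType) (T : choiceType) (W : growing_walk R T)
    (v : T) : Prop :=
  forall f g : duration,
    (forall n, (0 < n)%N -> (total_time f n <= total_time g n)%N) ->
    forall t, (0 < t)%N -> return_prob W f v t <= return_prob W g v t.

Lemma vert_le (R : realType) (T : choiceType) (W : growing_walk R T) m n u :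
  (0 < m)%N -> (m <= n)%N -> u \in vert W m -> u \in vert W n.
Proof.
move=> m0; elim: n => [|n IH]; first by rewrite leqn0 => /eqP m0'; rewrite m0' in m0.
rewrite leq_eqVlt => /orP[/eqP <- //|mn um].
by apply: vert_mono; [exact: leq_trans m0 mn | exact: IH].
Qed.

Lemma law_out (R : realType) (T : choiceType) (W : growing_walk R T)
    (f : duration) (v : T) : v \in vert W 1 ->
  forall t u, u \notin vert W (phase f t) -> law W f v t u = 0.
Proof.
move=> v1 [|t] u /=.
  have [p0 _ _] := phaseP f 0.
  case: eqVneq => // -> /negP[]; exact: vert_le v1.
case: ifP => // ut /negP[]; have [p0 _ _] := phaseP f t.
by apply: vert_le ut => //; apply: phase_mono.
Qed.

Lemma law_sum1 (R : realType) (T : choiceType) (W : growing_walk R T)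
    (f : duration) (v : T) : v \in vert W 1 ->
  forall t, \sum_(u <- vert W (phase f t)) law W f v t u = 1.
Proof.
move=> v1; elim=> [|t IH] /=.
  have [p0 _ _] := phaseP f 0.
  have vp : v \in vert W (phase f 0) by exact: vert_le v1.
  by rewrite (big_fsetD1 v) //= eqxx big1_fset ?addr0 // => i;
     rewrite !inE => /andP[/negPf ->].
have [p0 _ _] := phaseP f t.
set n := phase f t; set n' := phase f t.+1.
have sub : (vert W n `<=` vert W n')%fset.
  by apply/fsubsetP => u; apply: vert_le => //; apply: phase_mono.
rewrite -(big_fset_incl _ sub); last by move=> u _; rewrite /n => /negPf ->.
transitivity (\sum_(w <- vert W n) \sum_(u <- vert W n)
    law W f v t u * trans W n u w).
  by apply: eq_big_seq => u; rewrite /n => ->.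
rewrite exchange_big /= -[RHS]IH; apply: eq_big_seq => u un.
by rewrite -mulr_sumr (trans_stochastic W p0).2 // mulr1.
Qed.

(* [law] is the law of the walk: it gives the one-dimensional marginals of any
   process with initial state v and the prescribed one-step transitions. *)
Lemma law_process (R : realType) (T : choiceType) (W : growing_walk R T)
    (f : duration) (v : T) (d : measure_display) (Omega : measurableType d)
    (Pr : probability Omega R) (X : nat -> Omega -> T) :
  v \in vert W 1 ->
  (forall t u, measurable [set x | X t x = u]) ->
  Pr [set x | X 0 x = v] = 1%E ->
  (forall t u w, let n := phase f t in
    u \in vert W n ->
    Pr [set x | X t x = u /\ X t.+1 x = w] =
    (Pr [set x | X t x = u] *
     (if w \in vert W n then trans W n u w else 0)%:E)%E) ->
  forall t u, Pr [set x | X t x = u] = (law W f v t u)%:E.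
Proof.
move=> v1 mX X0 Xs; elim=> [|t IH] w.
  rewrite /=; case: (eqVneq w v) => [->|wv]; first by rewrite X0.
  apply/eqP; rewrite eq_le measure_ge0 andbT.
  have <- : Pr (~` [set x | X 0 x = v]) = 0%:E.
    by rewrite probability_setC // X0 subee.
  apply: le_measure; rewrite ?inE //; first exact: measurableC.
  by move=> x /= -> /eqP; rewrite (negPf wv).
pose V := vert W (phase f t).
pose F u := [set x | X t x = u].
have mU (A : {fset T}) (Q : set Omega) : measurable Q ->
    Pr (Q `&` [set x | X t x \in A]) = (\sum_(u <- A) Pr (Q `&` F u))%E.
  move=> mQ.
  have -> : Q `&` [set x | X t x \in A] =
      \bigcup_(u in [set` A]) (Q `&` F u).
    apply/seteqP; split => [x [Qx /= xA]|x [u /= uA [Qx /= Fx]]].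
      by exists (X t x).
    by split => //=; rewrite Fx.
  rewrite measure_fin_bigcup //; last first.
  - by move=> u _; apply: measurableI => //; exact: mX.
  - by move=> i j _ _ [x [[_ <-] [_ <-]]].
  by rewrite fsbig_finite //= set_fsetK.
have V1 : Pr [set x | X t x \in V] = 1%E.
  rewrite -[X in Pr X]setTI mU //.
  rewrite (eq_bigr (fun u => (law W f v t u)%:E)).
    by rewrite sumEFin law_sum1.
  by move=> u _; rewrite setTI IH.
have mV : measurable [set x | X t x \in V].
  have -> : [set x | X t x \in V] = \bigcup_(u in [set` V]) F u.
    by apply/seteqP; split => [x /= ?|x [u /= uV Fx]];
       [exists (X t x) | rewrite Fx].
  by apply: fin_bigcup_measurable => // u _; exact: mX.
pose Q := [set x | X t.+1 x = w].
have mQ : measurable Q by exact: mX.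
have -> : Pr Q = Pr (Q `&` [set x | X t x \in V]).
  apply/eqP; rewrite eq_le; apply/andP; split; last first.
    apply: le_measure; rewrite ?inE //; exact: measurableI.
  rewrite (measureDI Pr mQ mV) addeC -[leRHS]adde0 leeD2l //.
  have <- : Pr (~` [set x | X t x \in V]) = 0%E.
    by rewrite probability_setC // V1 subee.
  have mC : measurable (~` [set x | X t x \in V]) by exact: measurableC.
  by apply: le_measure; rewrite ?inE; [exact: measurableD | | move=> ? []].
rewrite mU // /= -/V.
have E u : u \in V -> Pr (Q `&` F u) =
    (law W f v t u * (if w \in V then trans W (phase f t) u w else 0))%:E.
  move=> uV; rewrite EFinM -IH -Xs //; congr (Pr _).
  by apply/seteqP; split => x [].
rewrite (eq_big_seq _ E) sumEFin; congr EFin.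
by case: ifP => // _; rewrite big1 // => u _; rewrite mulr0.
Qed.

(* Main.v *)
Require Import Defs.
From mathcomp Require Import all_boot all_order all_algebra finmap.
From mathcomp Require Import all_classical all_reals all_analysis.
From mathcomp Require Import zify ring lra.

(** Two comparisons bound the return probability at the even times of each
    phase from below.

    First, fix a phase n >= 1 and replace the duration d by the one that spends
    no time in the phases before n, stays in phase n until time T_n, and then
    agrees with d.  Its partial sums are at most those of d, so the
    less-homesick property says that the return probability at v can only
    decrease.  Up to time T_n the new walk is the homogeneous chain P_n started
    at v, hence R(t) >= P_n^t(v, v) for 0 < t <= T_n ([return_prob_ge]).

    Second, a reversible chain satisfies P^(2s)(v, v) >= pi(v) for its even-time
    stationary distribution pi ([even_stationary_le_return]).
    In the inner product <a, b> = sum_u a(u) b(u) / mu(u),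
    where mu is a reversing measure, the map a |-> a P on measures is
    self-adjoint, and expanding
      0 <= |delta_v P^s - pi P^s|^2
    gives P^(2s)(v, v) / mu(v) - 2 pi(v) / mu(v) + <pi, pi>.  The Dirichlet form
    of P^(2t) vanishes at the density pi / mu, so this density is constant on
    the even class of v ([stationary_density_eq]), which carries pi; thus
    <pi, pi> = pi(v) / mu(v), and the inequality follows.

    A phase of length d(n) contains at least (d(n) - 1) / 2 even times, and at
    each of them R(t) >= p(n).  So the partial sum of R up to T_N is at least
    half the N-th partial sum of (d(n) - 1) p(n), which diverges. *)

Set Implicit Arguments.
Unset Strict Implicit.
Unset Printing Implicit Defensive.

Import Order.TTheory GRing.Theory Num.Theory.

Local Open Scope ring_scope.

(** * Powers of a kernel *)

Lemma sum_delta (R : realType) (T : choiceType) (V : {fset T}) (w : T)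
    (F : T -> R) :
  w \in V -> \sum_(x <- V) (w == x)%:R * F x = F w.
Proof.
move=> wV; rewrite (big_fsetD1 w) //= eqxx mul1r big1_fset ?addr0 // => x.
by rewrite !inE eq_sym => /andP[/negPf -> _] _; rewrite mul0r.
Qed.

Lemma kpow_ge0 (R : realType) (T : choiceType) (V : {fset T})
    (K : T -> T -> R) :
  stochastic V K ->
  forall t u w, u \in V -> w \in V -> 0 <= kpow V K t u w.
Proof.
move=> [K0 _]; elim=> [|t IH] u w uV wV /=; first exact: ler0n.
rewrite big_seq; apply: sumr_ge0 => x xV.
by rewrite mulr_ge0 ?IH ?K0.
Qed.

Lemma kpow_sum1 (R : realType) (T : choiceType) (V : {fset T})
    (K : T -> T -> R) :
  stochastic V K ->
  forall t u, u \in V -> \sum_(w <- V) kpow V K t u w = 1.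
Proof.
move=> [_ K1]; elim=> [|t IH] u uV /=.
  rewrite -[RHS](@sum_delta _ _ V u (fun=> 1) uV).
  by apply: eq_bigr => x _; rewrite mulr1.
rewrite exchange_big /= -[RHS](IH u uV); apply: eq_big_seq => x xV.
by rewrite -mulr_sumr K1 // mulr1.
Qed.

Lemma kpowD (R : realType) (T : choiceType) (V : {fset T})
    (K : T -> T -> R) (s t : nat) (u w : T) : w \in V ->
  kpow V K (s + t) u w = \sum_(x <- V) kpow V K s u x * kpow V K t x w.
Proof.
elim: t w => [|t IH] w wV.
  rewrite addn0 /= -[LHS](@sum_delta _ _ V w _ wV).
  by apply: eq_bigr => x _; rewrite mulrC eq_sym.
rewrite addnS /=.
under eq_big_seq => y yV do rewrite (IH y yV) mulr_suml.
rewrite exchange_big /=; apply: eq_bigr => x _.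
by rewrite mulr_sumr; apply: eq_bigr => y _; rewrite mulrA.
Qed.

Lemma kpow_rev (R : realType) (T : choiceType) (V : {fset T})
    (K : T -> T -> R) (mu : T -> R) :
  (forall u w, u \in V -> w \in V -> mu u * K u w = mu w * K w u) ->
  forall t u w, u \in V -> w \in V ->
    mu u * kpow V K t u w = mu w * kpow V K t w u.
Proof.
move=> rev; elim=> [|t IH] u w uV wV.
  by rewrite /= eq_sym; case: eqVneq => [->|_] //; rewrite !mulr0.
rewrite -[in RHS]add1n kpowD //= !mulr_sumr; apply: eq_big_seq => x xV.
rewrite (@sum_delta _ _ V w (fun y => K y x)) //.
by rewrite mulrA IH // mulrAC rev // mulrA.
Qed.

(** * Self-adjoint evolution of measures *)

Definition evolve (R : realType) (T : choiceType) (V : {fset T})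
    (K : T -> T -> R) (a : T -> R) (t : nat) (w : T) : R :=
  \sum_(u <- V) a u * kpow V K t u w.

(** The inner product of the densities of [a] and [b] in L^2(mu): reversibility
    says exactly that the evolution of measures is self-adjoint for it. *)
Definition dens_dot (R : realType) (T : choiceType) (V : {fset T})
    (mu a b : T -> R) : R :=
  \sum_(u <- V) a u * b u / mu u.

Lemma evolveD (R : realType) (T : choiceType) (V : {fset T})
    (K : T -> T -> R) (a : T -> R) (s t : nat) (w : T) : w \in V ->
  evolve V K (evolve V K a s) t w = evolve V K a (s + t) w.
Proof.
move=> wV; rewrite /evolve; under eq_bigr do rewrite mulr_suml.
rewrite exchange_big /=; apply: eq_bigr => u _.
by rewrite kpowD // mulr_sumr; apply: eq_bigr => x _; rewrite mulrA.
Qed.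

Lemma evolve_delta (R : realType) (T : choiceType) (V : {fset T})
    (K : T -> T -> R) (v : T) (t : nat) (w : T) : v \in V ->
  evolve V K (fun u => (v == u)%:R) t w = kpow V K t v w.
Proof. exact: sum_delta. Qed.

Lemma evolve_stationary (R : realType) (T : choiceType) (V : {fset T})
    (K : T -> T -> R) (a : T -> R) :
  (forall w, w \in V -> evolve V K a 2 w = a w) ->
  forall t w, w \in V -> evolve V K a (2 * t) w = a w.
Proof.
move=> st; elim=> [|t IH] w wV.
  rewrite /evolve muln0 /= -[RHS](@sum_delta _ _ V w a wV).
  by apply: eq_bigr => x _; rewrite mulrC eq_sym.
rewrite mulnS -evolveD // -[RHS]IH //.
by rewrite /evolve; apply: eq_big_seq => u uV; rewrite -[in RHS]st.
Qed.

Lemma eq_dens_dot (R : realType) (T : choiceType) (V : {fset T})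
    (mu a b a' b' : T -> R) :
  (forall u, u \in V -> a u = a' u) -> (forall u, u \in V -> b u = b' u) ->
  dens_dot V mu a b = dens_dot V mu a' b'.
Proof.
by move=> aa' bb'; apply: eq_big_seq => u uV; rewrite aa' ?bb'.
Qed.

Lemma evolve_adjoint (R : realType) (T : choiceType) (V : {fset T})
    (K : T -> T -> R) (mu : T -> R) :
  (forall u, u \in V -> 0 < mu u) ->
  (forall u w, u \in V -> w \in V -> mu u * K u w = mu w * K w u) ->
  forall a b t,
    dens_dot V mu (evolve V K a t) b = dens_dot V mu a (evolve V K b t).
Proof.
move=> mu0 rev a b t; rewrite /dens_dot /evolve.
under eq_bigr do rewrite !mulr_suml.
under [RHS]eq_bigr do rewrite mulr_sumr mulr_suml.
rewrite exchange_big /=; apply: eq_big_seq => u uV; apply: eq_big_seq => w wV.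
have u0 : mu u != 0 by rewrite gt_eqF // mu0.
have w0 : mu w != 0 by rewrite gt_eqF // mu0.
have kE : kpow V K t u w = mu w * kpow V K t w u / mu u.
  by rewrite -(kpow_rev rev) // mulrC mulKf.
by rewrite kE; field; rewrite u0 w0.
Qed.

Lemma evolve_dot (R : realType) (T : choiceType) (V : {fset T})
    (K : T -> T -> R) (mu : T -> R) :
  (forall u, u \in V -> 0 < mu u) ->
  (forall u w, u \in V -> w \in V -> mu u * K u w = mu w * K w u) ->
  forall a b t,
    dens_dot V mu (evolve V K a t) (evolve V K b t) =
    dens_dot V mu a (evolve V K b (2 * t)).
Proof.
move=> mu0 rev a b t; rewrite evolve_adjoint //; apply: eq_dens_dot => // u uV.
by rewrite evolveD // mul2n addnn.
Qed.

(** * Return probabilities and the even-time stationary distribution *)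

(** The Dirichlet form of P^t at h = a / mu is
      sum_(u, w) mu(u) P^t(u, w) (h(u) - h(w))^2 = 2 <a, a> - 2 <a P^t, a>,
    which is 0 as a P^t = a; its terms are nonnegative, so each of them is 0. *)
Lemma stationary_density_eq (R : realType) (T : choiceType) (V : {fset T})
    (K : T -> T -> R) (mu a : T -> R) (t : nat) :
  stochastic V K ->
  (forall u, u \in V -> 0 < mu u) ->
  (forall u w, u \in V -> w \in V -> mu u * K u w = mu w * K w u) ->
  (forall w, w \in V -> evolve V K a t w = a w) ->
  forall u w, u \in V -> w \in V -> kpow V K t u w != 0 ->
    a u / mu u = a w / mu w.
Proof.
move=> sK mu0 rev st.
pose F u w := mu u * kpow V K t u w * (a u / mu u - a w / mu w) ^+ 2.
have F0 u w : u \in V -> w \in V -> 0 <= F u w.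
  move=> uV wV; rewrite mulr_ge0 ?sqr_ge0 //.
  by rewrite mulr_ge0 ?(ltW (mu0 _ uV)) ?kpow_ge0.
have sumF : \sum_(u <- V) \sum_(w <- V) F u w = 0.
  (* Reversibility moves mu from u to w in the square of h(w), so that both
     squares can be summed along a row of P^t. *)
  have FE u w : u \in V -> w \in V -> F u w =
      a u ^+ 2 / mu u * kpow V K t u w - 2 * (a u * kpow V K t u w * a w / mu w)
      + a w ^+ 2 / mu w * kpow V K t w u.
    move=> uV wV; have u0 : mu u != 0 by rewrite gt_eqF // mu0.
    have w0 : mu w != 0 by rewrite gt_eqF // mu0.
    have kE : kpow V K t w u = mu u * kpow V K t u w / mu w.
      by rewrite (kpow_rev rev) // mulrC mulKf.
    by rewrite /F kE; field; rewrite u0 w0.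
  under eq_big_seq => u uV.
    under eq_big_seq => w wV do rewrite FE //.
    over.
  have row (c : T -> R) : \sum_(u <- V) \sum_(w <- V) c u * kpow V K t u w
      = \sum_(u <- V) c u.
    by apply: eq_big_seq => u uV; rewrite -mulr_sumr kpow_sum1 ?mulr1.
  have cross : \sum_(u <- V) \sum_(w <- V) a u * kpow V K t u w * a w / mu w
      = \sum_(u <- V) a u ^+ 2 / mu u.
    rewrite exchange_big /=; apply: eq_big_seq => w wV.
    rewrite -!mulr_suml -/(evolve V K a t w) st //.
  under eq_bigr do rewrite big_split /= sumrB -[\sum_(_ <- _) 2 * _]mulr_sumr.
  rewrite big_split /= sumrB -[\sum_(_ <- _) 2 * _]mulr_sumr cross row.
  rewrite [X in _ + X]exchange_big /= row.
  by ring.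
move=> u w uV wV kn0.
have : F u w == 0.
  move/eqP: sumF; rewrite big_seq psumr_eq0; last first.
    by move=> x xV; rewrite big_seq sumr_ge0 // => y yV; exact: F0.
  move=> /allP/(_ u uV)/=; rewrite uV /= big_seq psumr_eq0; last first.
    by move=> y yV; exact: F0.
  by move=> /allP/(_ w wV)/=; rewrite wV.
rewrite /F !mulf_eq0 (negPf kn0) gt_eqF ?mu0 //= orbb subr_eq0.
by move=> /eqP.
Qed.

(** On the even class of v the density pi / mu equals its value at v, and off it
    pi is 0; so <pi, pi> is that value times the total mass of pi. *)
Lemma even_stationary_norm (R : realType) (T : choiceType) (V : {fset T})
    (K : T -> T -> R) (v : T) (pi mu : T -> R) :
  v \in V -> stochastic V K ->
  (forall u, u \in V -> 0 < mu u) ->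
  (forall u w, u \in V -> w \in V -> mu u * K u w = mu w * K w u) ->
  even_stationary V K v pi ->
  dens_dot V mu pi pi = pi v / mu v.
Proof.
move=> vV sK mu0 rev [_ pi1 out st].
rewrite -[RHS]mul1r -pi1 mulr_suml; apply: eq_big_seq => u uV.
have [[_ [t kn0]]|uE] := pselect (even_class V K v u); last first.
  by rewrite out // !mul0r.
rewrite -mulrA; congr (_ * _); symmetry.
by apply: stationary_density_eq kn0 => // w; exact: evolve_stationary.
Qed.

(** The squared distance from delta_v P^s to pi P^s is nonnegative.  For odd s
    the measure pi P^s may differ from pi (it lives on the other parity class
    when the period is 2), but by self-adjointness the three inner products in the expansion only involve
    P^(2s), which fixes pi. *)
Lemma even_stationary_le_return (R : realType) (T : choiceType) (V : {fset T})
    (K : T -> T -> R) (v : T) (pi : T -> R) (s : nat) :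
  v \in V -> stochastic V K -> reversible V K -> even_stationary V K v pi ->
  pi v <= kpow V K (2 * s) v v.
Proof.
move=> vV sK [mu [mu0 rev]] piE.
have norm := even_stationary_norm vV sK mu0 rev piE.
have [_ _ _ st] := piE.
have v0 := mu0 v vV.
pose dv u : R := (v == u)%:R.
have dvE b : dens_dot V mu dv b = b v / mu v.
  rewrite -[RHS](@sum_delta _ _ V v (fun u => b u / mu u)) //.
  by apply: eq_bigr => u _; rewrite mulrA.
have dd : dens_dot V mu (evolve V K dv s) (evolve V K dv s) =
    kpow V K (2 * s) v v / mu v.
  by rewrite evolve_dot // dvE evolve_delta.
have dp : dens_dot V mu (evolve V K dv s) (evolve V K pi s) = pi v / mu v.
  by rewrite evolve_dot // dvE evolve_stationary.
have pp : dens_dot V mu (evolve V K pi s) (evolve V K pi s) = pi v / mu v.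
  rewrite evolve_dot // -norm; apply: eq_dens_dot => // u uV.
  exact: evolve_stationary.
have : 0 <= \sum_(u <- V) (evolve V K dv s u - evolve V K pi s u) ^+ 2 / mu u.
  rewrite big_seq sumr_ge0 // => u uV.
  by rewrite mulr_ge0 ?sqr_ge0 // invr_ge0 ltW // mu0.
rewrite (_ : \sum_(u <- V) _ = kpow V K (2 * s) v v / mu v - pi v / mu v).
  by rewrite subr_ge0 ler_pM2r // invr_gt0.
transitivity (dens_dot V mu (evolve V K dv s) (evolve V K dv s)
  - 2 * dens_dot V mu (evolve V K dv s) (evolve V K pi s)
  + dens_dot V mu (evolve V K pi s) (evolve V K pi s)).
  rewrite /dens_dot mulr_sumr -sumrB -big_split /=.
  by apply: eq_bigr => u _; ring.
by rewrite dd dp pp; ring.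
Qed.

(** * Comparison with the walk that jumps to phase n *)

(** Phase [n] absorbs all the time that [d] spends in the phases before it, so
    that later phases keep their starting times. *)
Definition jump (d : nat -> nat) (n i : nat) : nat :=
  if (i < n)%N then 0%N else if i == n then total_time d n else d i.

Lemma total_timeS (d : nat -> nat) (n : nat) :
  total_time d n.+1 = (total_time d n + d n.+1)%N.
Proof. by rewrite /total_time big_nat_recr. Qed.

Lemma total_time_jump (d : nat -> nat) (n i : nat) : (0 < n)%N ->
  total_time (jump d n) i = if (i < n)%N then 0%N else total_time d i.
Proof.
move=> n0; elim: i => [|i IH]; first by rewrite n0 /total_time big_geq.
rewrite total_timeS IH /jump; have [lt_in|le_ni] := ltnP i.+1 n.
  by rewrite ltnW.
case: eqVneq => [<-|i1n]; first by rewrite ltnSn.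
by rewrite ltnNge -ltnS ltn_neqAle eq_sym i1n le_ni /= total_timeS.
Qed.

Lemma jump_infty (d : duration) (n : nat) : (0 < n)%N ->
  (total_time (jump d n) m @[m --> \oo] --> \oo)%classic.
Proof.
move=> n0; apply: cvg_trans (@dur_infty d); apply: near_eq_cvg.
near=> m; rewrite total_time_jump // ltnNge.
by rewrite (_ : (n <= m)%N) //; near: m; exact: nbhs_infty_ge.
Unshelve. all: by end_near. Qed.

Definition jump_duration (d : duration) (n : nat) (n0 : (0 < n)%N) : duration :=
  Duration (jump_infty d n0).

Lemma phase_jump (d : duration) (n : nat) (n0 : (0 < n)%N) (t : nat) :
  (t < total_time d n)%N -> phase (jump_duration d n0) t = n.
Proof.
move=> tn; rewrite /phase; case: ex_minnP => m /=.
rewrite total_time_jump // => tm /(_ n) /=.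
rewrite total_time_jump // ltnn => /(_ tn) mn; apply/eqP.
by rewrite eqn_leq mn leqNgt; apply/negP => mn'; rewrite mn' in tm.
Qed.

Lemma law_jump (R : realType) (T : choiceType) (W : growing_walk R T)
    (d : duration) (n : nat) (n0 : (0 < n)%N) (v : T) (t : nat) (w : T) :
  (t <= total_time d n)%N -> w \in vert W n ->
  law W (jump_duration d n0) v t w = kpow (vert W n) (trans W n) t v w.
Proof.
elim: t w => [|t IH] w tn wn /=; first by rewrite eq_sym.
rewrite phase_jump // wn; apply: eq_big_seq => u un.
by rewrite IH // ltnW.
Qed.

Lemma law_ge0 (R : realType) (T : choiceType) (W : growing_walk R T)
    (f : duration) (v : T) (t : nat) (w : T) : 0 <= law W f v t w.
Proof.
elim: t w => [|t IH] w /=; first exact: ler0n.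
case: ifP => // wn; rewrite big_seq sumr_ge0 // => u un.
have [p0 _ _] := phaseP f t.
by rewrite mulr_ge0 // (trans_stochastic W p0).1.
Qed.

(** The less-homesick property applied to the jumping duration, whose partial
    sums are those of [d] from [n] on and 0 before. *)
Lemma return_prob_ge (R : realType) (T : choiceType) (W : growing_walk R T)
    (d : duration) (v : T) (n t : nat) :
  v \in vert W 1 -> lhagg W v -> (0 < n)%N -> (0 < t <= total_time d n)%N ->
  kpow (vert W n) (trans W n) t v v <= return_prob W d v t.
Proof.
move=> v1 HW n0 /andP[t0 tn]; rewrite -(@law_jump _ _ _ d _ n0) //; last first.
  exact: vert_le v1.
by apply: HW => // m _ /=; rewrite total_time_jump //; case: ifP.
Qed.

(** * Counting even times *)

(** Two consecutive times contain an even one, so lengthening the block by two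
    adds at least p to the sum;
    the offset -1 pays for a block made of one odd time. *)
Lemma even_block (R : realType) (r : nat -> R) (p : R) (a d : nat) :
  0 <= p -> (forall t, 0 <= r t) ->
  (forall t, ~~ odd t -> (a < t <= a + d)%N -> p <= r t) ->
  (d%:R - 1) * p <= 2 * \sum_(a.+1 <= t < (a + d).+1) r t.
Proof.
move=> p0 r0; elim/ltn_ind: d => -[|[|d]] IH H.
- rewrite addn0 big_geq //; nra.
- rewrite subrr mul0r mulr_ge0 // big_nat_cond sumr_ge0 //.
have H' t : ~~ odd t -> (a < t <= a + d)%N -> p <= r t.
  move=> et /andP[at_ td]; apply: H => //; rewrite at_ /=; lia.
have {IH H'} := IH d (ltnW (ltnSn _)) H'.
have -> : \sum_(a.+1 <= t < (a + d.+2).+1) r t =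
    \sum_(a.+1 <= t < (a + d).+1) r t + (r (a + d).+1 + r (a + d).+2).
  have lo k : (a < (a + d + k).+1)%N by rewrite ltnS -addnA leq_addr.
  have lo1 := lo 1%N; have lo0 := lo 0%N; rewrite !addnS addn0 in lo1 lo0.
  by rewrite !addnS big_nat_recr //= big_nat_recr //= addrA.
set S := \sum_(_ <= _ < _) _ => IH.
have two : p <= r (a + d).+1 + r (a + d).+2.
  have [od|ev] := boolP (odd (a + d)).
    rewrite -[leLHS]addr0 lerD // H //=; first by rewrite od.
    lia.
  rewrite -[leLHS]add0r lerD // H //=; first by rewrite negbK.
  lia.
rewrite -[d.+2]addn2 natrD; nra.
Qed.

(** * Recurrence *)

Theorem lemma3p2 (R : realType) (T : choiceType) (D : rwogg R T) (v : T)
    (v1 : v \in vert D 1) (HD : lhagg D v)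
    (Hirr : forall n, (0 < n)%N -> irreducible (vert D n) (trans D n))
    (Hrev : forall n, (0 < n)%N -> reversible (vert D n) (trans D n))
    (Hper : forall n, (0 < n)%N -> has_period (vert D n) (trans D n) 2)
    (pi : nat -> T -> R)
    (Hpi : forall n, (0 < n)%N ->
      even_stationary (vert D n) (trans D n) v (pi n))
    (Hsum : sum_infty (fun n => ((rw_dur D n)%:R - 1) * pi n v)) :
  recurrent D v.
Proof.
pose d := rw_dur D; pose r := return_prob D d v.
have r0 t : 0 <= r t by exact: law_ge0.
have vn n : (0 < n)%N -> v \in vert D n by move=> n0; exact: vert_le v1.
have pi_le n t : (0 < n)%N -> ~~ odd t -> (0 < t <= total_time d n)%N ->
    pi n v <= r t.
  move=> n0 et tn; apply: le_trans (return_prob_ge v1 HD n0 tn).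
  rewrite (_ : t = 2 * t./2)%N; last by rewrite mul2n even_halfK.
  apply: even_stationary_le_return; [exact: vn| |exact: Hrev|exact: Hpi].
  exact: trans_stochastic.
have partial N : \sum_(1 <= n < N.+1) ((d n)%:R - 1) * pi n v <=
    2 * \sum_(1 <= t < (total_time d N).+1) r t.
  elim: N => [|N IH]; first by rewrite /total_time !big_geq ?mulr0.
  rewrite big_nat_recr //= total_timeS.
  rewrite [X in _ <= 2 * X](@big_cat_nat _ _ _ (total_time d N).+1) //=;
    last by rewrite ltnS leq_addr.
  rewrite mulrDr lerD // even_block //.
    by have [pi0 _ _ _] := Hpi N.+1 isT; exact/pi0/vn.
  move=> t et /andP[Nt tN]; apply: pi_le => //.
  by rewrite total_timeS tN (leq_ltn_trans _ Nt).
apply/cvgryPge => A; move/cvgryPge: Hsum => /(_ (2 * A)).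
move=> [N _ /(_ N (leqnn N)) HN].
exists (total_time d N) => // M /= NM.
have {HN} : A <= \sum_(1 <= t < (total_time d N).+1) r t.
  by rewrite -(ler_pM2l (ltr0n R 2)); exact: le_trans HN (partial N).
move=> /le_trans; apply.
rewrite [leRHS](@big_cat_nat _ _ _ (total_time d N).+1) //=.
by rewrite lerDl sumr_ge0.
Qed.
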